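(* Let $A$ be a commutative ring and $n\ge 0$ an integer. If $\mathrm{Hdim}\,A<n$ and $a,b_1,\dots,b_n\in A$ satisfy $1\in\langle a,b_1,\dots,b_n\rangle$, then there exist $x_1,\dots,x_n\in A$ such that $1\in\langle b_1+ax_1,\dots,b_n+ax_n\rangle$.
   Context: For a commutative ring $A$, let $\mathrm{J}_A(0)=\{x\in A:\forall y\in A,\ 1+xy \text{ is invertible}\}$ be its Jacobson radical. For $x\in A$ the Heitmann boundary ideal of $x$ is $\mathrm{H}_A(x)=xA+(\mathrm{J}_A(0):x)$, where $(\mathrm{J}_A(0):x)=\{b\in A: bx\in \mathrm{J}_A(0)\}$. The Heitmann dimension is defined inductively: $\mathrm{Hdim}\,A\le -1$ iff $1=0$ in $A$; for $\ell\ge 0$, $\mathrm{Hdim}\,A\le \ell$ iff $\mathrm{Hdim}(A/\mathrm{H}_A(x))\le\ell-1$ for all $x\in A$. $\mathrm{Hdim}\,A<n$ means $\mathrm{Hdim}\,A\le n-1$. No noetherian hypothesis is made. *)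

(* Defs.v *)
From HB Require Import structures.
From mathcomp Require Import all_boot all_algebra ring_quotient.
From mathcomp Require Import generic_quotient.
From mathcomp Require Import boolp classical_sets.

Set Implicit Arguments.
Unset Strict Implicit.
Unset Printing Implicit Defensive.

Import GRing.Theory.

Local Open Scope ring_scope.
Local Open Scope classical_set_scope.

(* The rings below are [comPzRingType]s, so that the zero ring, on which the
   definition of the Heitmann dimension bottoms out, is included.  The ideals
   and quotient rings of [ring_quotient] are restricted to proper ideals of
   nonzero rings; here is the same construction without that restriction. *)

HB.mixin Record isMulAbsorbing (R : comPzRingType) (S : R -> bool) := {
  ideal_mull : forall a, {in S, forall u, a * u \in S}
}.

#[short(type="ideal")]
HB.structure Definition Ideal (R : comPzRingType) :=
  {S of GRing.ZmodClosed R S & isMulAbsorbing R S}.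

Definition quot_ring (R : comPzRingType) (I : ideal R) := Quotient.quot I.

Section QuotRing.
Local Open Scope quotient_scope.
Variables (R : comPzRingType) (I : ideal R).
Local Notation Q := (quot_ring I).

HB.instance Definition _ : EqQuotient R (Quotient.equiv I) Q :=
  EqQuotient.on Q.
HB.instance Definition _ := Choice.on Q.
HB.instance Definition _ := GRing.Zmodule.on Q.
HB.instance Definition _ := @isZmodQuotient.Build R (Quotient.equiv I)
  0 -%R +%R Q (@pi_zeror _ _ _ _ _ (Quotient.quot I))
  (@pi_oppr _ _ _ _ _ (Quotient.quot I))
  (@pi_addr _ _ _ _ _ (Quotient.quot I)).

Definition quot_one : Q := lift_cst Q 1.
Definition quot_mul := lift_op2 Q *%R.

Canonical pi_quot_one_morph := PiConst quot_one.

Lemma pi_quot_mul : {morph \pi_Q : x y / x * y >-> quot_mul x y}.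
Proof.
move=> x y; unlock quot_mul; apply/eqP; rewrite piE Quotient.equivE.
have E z : z - repr (\pi_Q z) \in I.
  by rewrite (Quotient.idealrBE I); apply/eqP; rewrite reprK.
rewrite -[x * y](addrNK (x * repr (\pi_Q y))) -mulrBr -addrA -mulrBl.
apply: rpredD; first exact: ideal_mull.
by rewrite mulrC; apply: ideal_mull.
Qed.
Canonical pi_quot_mul_morph := PiMorph2 pi_quot_mul.

Fact quot_mulA : associative quot_mul.
Proof. by move=> x y z; rewrite -[x]reprK -[y]reprK -[z]reprK !piE mulrA. Qed.

Fact quot_mulC : commutative quot_mul.
Proof. by move=> x y; rewrite -[x]reprK -[y]reprK !piE mulrC. Qed.

Fact quot_mul1l : left_id quot_one quot_mul.
Proof. by move=> x; rewrite -[x]reprK !piE mul1r. Qed.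

Fact quot_mulDl : left_distributive quot_mul +%R.
Proof.
move=> x y z; rewrite -[x]reprK -[y]reprK -[z]reprK.
by rewrite !piE mulrDl.
Qed.

HB.instance Definition _ := GRing.Zmodule_isComPzRing.Build Q
  quot_mulA quot_mulC quot_mul1l quot_mulDl.

End QuotRing.

Section Heitmann.
Variable A : comPzRingType.

(* [comPzRingType] carries no unit predicate. *)
Definition invertible (u : A) : Prop := exists v, u * v = 1.

Definition jacobson : set A := [set x | forall y, invertible (1 + x * y)].

Definition heitmann (x : A) : set A :=
  [set x * u + b | u in [set: A] & b in [set b | jacobson (b * x)]].

Fact jacobsonM a x : jacobson x -> jacobson (a * x).
Proof. by move=> Jx y; rewrite mulrAC [a * y * x]mulrC; apply: Jx. Qed.

Fact jacobsonD x y : jacobson x -> jacobson y -> jacobson (x + y).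
Proof.
move=> Jx Jy z; have [v xv] := Jx z; have [w yw] := Jy (z * v).
exists (v * w).
have -> : 1 + (x + y) * z = (1 + x * z) + y * z by rewrite mulrDl addrA.
by rewrite mulrA mulrDl xv -!mulrA yw.
Qed.

Section HeitmannIdeal.
Variable x : A.

Definition heitmann_pred : A -> bool := fun z => z \in heitmann x.

Fact heitmannM a z : heitmann x z -> heitmann x (a * z).
Proof.
case=> u _ [b /= Jb <-]; exists (a * u) => //; exists (a * b).
  by rewrite /= -mulrA; apply: jacobsonM.
by rewrite mulrDr mulrCA.
Qed.

Fact heitmannD y z : heitmann x y -> heitmann x z -> heitmann x (y + z).
Proof.
case=> u _ [b /= Jb <-] [v _ [c /= Jc <-]].
exists (u + v) => //; exists (b + c).
  by rewrite /= mulrDl; apply: jacobsonD.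
by rewrite mulrDr addrACA.
Qed.

Fact heitmann0 : heitmann x 0.
Proof.
exists 0 => //; exists 0; last by rewrite mulr0 addr0.
by move=> y /=; exists 1; rewrite !mul0r addr0 mulr1.
Qed.

Fact heitmann_zmod_closed : zmod_closed heitmann_pred.
Proof.
split=> [|y z]; rewrite -!topredE /= /heitmann_pred !inE.
  exact: heitmann0.
move=> Hy Hz; apply: heitmannD Hy _.
by rewrite -mulN1r; apply: heitmannM.
Qed.

Fact heitmann_mull a : {in heitmann_pred, forall z, a * z \in heitmann_pred}.
Proof.
by move=> z; rewrite -!topredE /= /heitmann_pred !inE; apply: heitmannM.
Qed.

End HeitmannIdeal.

HB.instance Definition _ (x : A) :=
  GRing.isZmodClosed.Build A (heitmann_pred x) (heitmann_zmod_closed x).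
HB.instance Definition _ (x : A) := isMulAbsorbing.Build A (heitmann_pred x)
  (@heitmann_mull x).

Definition heitmann_quot (x : A) : comPzRingType :=
  quot_ring (Ideal.clone A (heitmann_pred x) _).

(* The ideal <s_0, ..., s_(k-1)>; it is the zero ideal when s is empty. *)
Definition ideal_gen (s : seq A) : set A :=
  [set z | exists c : 'I_(size s) -> A, z = \sum_i c i * s`_i].

End Heitmann.

(* [Hdim_lt A n] is Hdim A < n, that is, Hdim A <= n - 1: the recursion on the
   bound l >= -1 is indexed by n = l + 1. *)
Fixpoint Hdim_lt (A : comPzRingType) (n : nat) : Prop :=
  if n is m.+1 then forall x : A, Hdim_lt (heitmann_quot x) m
  else 1 = 0 :> A.

(* Main.v *)
Require Import Defs.
From HB Require Import structures.
From mathcomp Require Import all_boot all_algebra.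
From mathcomp Require Import generic_quotient ring_quotient.
From mathcomp Require Import classical_sets.
From mathcomp Require Import ring.

Import GRing.Theory.

Local Open Scope ring_scope.
Local Open Scope classical_set_scope.

(** The argument is an induction on [n], one boundary quotient at a time.  Put
    [H] for the boundary ideal of the first entry [b0].  In [A/H] the entry
    [b0] vanishes, so [a] and the remaining entries [b_i] still generate the
    unit ideal there, and [Hdim (A/H) < n - 1] yields multipliers [x_i].
    Lifted to [A], with [L] the ideal of the [b_i + a x_i], this says
    [1 = l + b0 u + y] with [l] in [L] and [y b0] in the Jacobson radical
    ([heitmann_quot_lift]).  That same [y] works as the missing
    multiplier: [b0] is replaced by [b0 + a y].

    To see this, take a maximal ideal containing [L] and [b0 + a y].  It
    contains [b0 y], hence [b0] or [y].  If it contains [y], it also contains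
    [b0 = (b0 + a y) - a y]; if it contains [b0], it contains [a y], hence
    [y] or [a].  Containing [y] and [b0] contradicts [1 = l + b0 u + y], and
    containing [a] and [b0] contradicts the unimodularity of [a, b0, b_i],
    since each [b_i] is congruent to [- a x_i].

    [boundary_congruence] is the same argument without maximal ideals: modulo
    [L + (b0 + a y)] the element [y] is a unit, so [b0] and [a] are explicit
    multiples of [j = b0 y]; then so is [1], and [1 - j t] is a unit of [A]
    because [j] is in the radical. *)

(** * Generated ideals *)

(** Ideals as plain predicates rather than bundled [ideal]s, so that preimages
    and images under the projections to quotients need no structure. *)
Definition is_ideal (R : comPzRingType) (P : R -> Prop) : Prop :=
  [/\ P 0, forall y z, P y -> P z -> P (y + z) & forall c z, P z -> P (c * z)].

Lemma ideal_gen_ideal (R : comPzRingType) (s : seq R) : is_ideal R (ideal_gen s).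
Proof.
split=> [|y z [c ->] [d ->]|e z [c ->]].
- by exists (fun=> 0); rewrite big1 // => i _; rewrite mul0r.
- exists (fun i => c i + d i); rewrite -big_split /=.
  by apply: eq_bigr => i _; rewrite mulrDl.
- exists (fun i => e * c i); rewrite mulr_sumr.
  by apply: eq_bigr => i _; rewrite mulrA.
Qed.

Lemma ideal_gen_mem (R : comPzRingType) (s : seq R) (z : R) :
  z \in s -> ideal_gen s z.
Proof.
move=> /(nthP 0) [k lt_ks <-].
exists (fun i => (i == Ordinal lt_ks)%:R).
rewrite (bigD1 (Ordinal lt_ks)) //= eqxx mul1r big1 ?addr0 // => i /negbTE->.
by rewrite mul0r.
Qed.

(** With [ideal_gen_ideal] and [ideal_gen_mem], this is the universal property
    of [ideal_gen s], through which all sums of generators are handled. *)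
Lemma ideal_gen_min (R : comPzRingType) (s : seq R) (P : R -> Prop) (z : R) :
  is_ideal R P -> (forall y, y \in s -> P y) -> ideal_gen s z -> P z.
Proof.
move=> [P0 PD PM] Ps [c ->]; apply: (big_ind P) => // i _.
by apply/PM/Ps/mem_nth.
Qed.

(** * The projection to a quotient *)

Definition quot_proj (R : comPzRingType) (I : ideal R) (z : R) : quot_ring I :=
  \pi_(quot_ring I)%qT z.

Section QuotProj.
Variables (R : comPzRingType) (I : ideal R).

Fact quot_proj_zmod_morphism : zmod_morphism (quot_proj R I).
Proof. by move=> y z; rewrite /quot_proj !piE. Qed.

Fact quot_proj_monoid_morphism : monoid_morphism (quot_proj R I).
Proof. by split=> [|y z]; rewrite /quot_proj !piE. Qed.

HB.instance Definition _ := GRing.isZmodMorphism.Build R (quot_ring I)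
  (quot_proj R I) quot_proj_zmod_morphism.
HB.instance Definition _ := GRing.isMonoidMorphism.Build R (quot_ring I)
  (quot_proj R I) quot_proj_monoid_morphism.

Lemma quot_projK (q : quot_ring I) : quot_proj R I (repr q) = q.
Proof. exact: reprK. Qed.

Lemma quot_proj_eq (y z : R) :
  quot_proj R I y = quot_proj R I z -> y - z \in I.
Proof. by move=> /eqP; rewrite (Quotient.idealrBE I). Qed.

Lemma quot_proj_eq0 (z : R) : z \in I -> quot_proj R I z = 0.
Proof.
by rewrite -[z in z \in I]subr0 (Quotient.idealrBE I) => /eqP; rewrite piE.
Qed.

End QuotProj.

Section IdealTransport.
Variables (R S : comPzRingType) (f : {rmorphism R -> S}).

Lemma is_ideal_preimage (P : S -> Prop) :
  is_ideal S P -> is_ideal R (fun z => P (f z)).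
Proof.
move=> [P0 PD PM]; split=> [|y z Py Pz|c z Pz].
- by rewrite rmorph0.
- by rewrite rmorphD; apply: PD.
- by rewrite rmorphM; apply: PM.
Qed.

Lemma is_ideal_image (P : R -> Prop) :
    (forall q, exists z, f z = q) ->
  is_ideal R P -> is_ideal S (fun q => exists2 z, P z & f z = q).
Proof.
move=> f_surj [P0 PD PM]; split=> [|_ _ [y Py <-] [z Pz <-]|q _ [z Pz <-]].
- by exists 0; rewrite ?rmorph0.
- by exists (y + z); [apply: PD | rewrite rmorphD].
- have [c <-] := f_surj q.
  by exists (c * z); [apply: PM | rewrite rmorphM].
Qed.

End IdealTransport.

(** * One step through the boundary quotient *)

Section HeitmannStep.
Variable A : comPzRingType.

Definition heitmann_proj (x : A) : {rmorphism A -> heitmann_quot x} :=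
  quot_proj A (Ideal.clone A (heitmann_pred x) _).

Lemma heitmann_projK (x : A) (q : heitmann_quot x) :
  heitmann_proj x (repr q) = q.
Proof. exact: quot_projK. Qed.

Lemma heitmann_proj_self (x : A) : heitmann_proj x x = 0.
Proof.
apply: quot_proj_eq0; rewrite -topredE /= /heitmann_pred inE.
exists 1 => //; exists 0; last by rewrite mulr1 addr0.
by move=> y /=; exists 1; rewrite !mul0r addr0 mulr1.
Qed.

(** An ideal whose image in the boundary quotient is the unit ideal becomes
    the unit ideal of [A] on adding [x] and a single element [y] with [y * x]
    in the radical: [1 - z] lies in the boundary ideal for some [z] in [P]. *)
Lemma heitmann_quot_lift (x : A) (P : A -> Prop) :
    (exists2 z, P z & heitmann_proj x z = 1) ->
  exists y u z, [/\ jacobson (y * x), P z & 1 = z + (x * u + y)].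
Proof.
move=> [z Pz]; rewrite -(rmorph1 (heitmann_proj x)) => /esym.
move=> /quot_proj_eq; rewrite -topredE /= /heitmann_pred inE.
move=> [u _ [y /= Jy def_1z]]; exists y, u, z; split=> //.
by rewrite def_1z addrC subrK.
Qed.

Lemma jacobson_ideal1 (P : A -> Prop) (j t : A) :
  is_ideal A P -> jacobson j -> P (1 - j * t) -> P 1.
Proof.
move=> [_ _ PM] Jj Pt; have [v] := Jj (- t).
by rewrite mulrN mulrC => <-; apply: PM.
Qed.

(** The ideal [Q] generated by [P] and [j = y * b] contains [a] and [b]:
    with [w = 1 - u * a] the hypotheses give [y * w = 1] modulo [P], so
    [b = w * j] and [a = a * y * w = - b * w].  Unimodularity is phrased
    through ideals [Q] above [P] because the remaining entries of the
    unimodular row are known only modulo [P], as multiples of [a]. *)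
Lemma boundary_congruence (P : A -> Prop) (a b y u z : A) :
    is_ideal A P -> jacobson (y * b) -> P (b + a * y) ->
    P z -> 1 = z + (b * u + y) ->
    (forall Q : A -> Prop, is_ideal A Q -> (forall p, P p -> Q p) ->
      Q a -> Q b -> Q 1) ->
  P 1.
Proof.
move=> idP Jj Pbay Pz def1 unimod; have [P0 PD PM] := idP.
pose Q p := exists t, P (p - y * b * t).
have subPQ p : P p -> Q p by move=> Pp; exists 0; rewrite mulr0 subr0.
have idQ : is_ideal A Q.
  split=> [|p q [s Ps] [t Pt]|c p [t Pt]]; first exact: subPQ.
  - by exists (s + t); rewrite mulrDr opprD addrACA; apply: PD.
  - by exists (c * t); rewrite mulrCA -mulrBr; apply: PM.
have [_ QD QM] := idQ.
pose w := 1 - u * a; pose p := z + u * (b + a * y).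
have Pp : P p by apply: PD => //; apply: PM.
have def1' : 1 = p + y * w by rewrite def1 /p /w; ring.
have Qb : Q b.
  exists w; have -> : b - y * b * w = b * p; last exact: PM.
  by rewrite -{1}[b]mulr1 def1'; ring.
have Qa : Q a.
  have -> : a = a * p + w * (b + a * y) + (- w) * b.
    by rewrite -{1}[a]mulr1 def1'; ring.
  by apply: (QD); [apply: (QD); apply: (QM); apply: subPQ | apply: QM].
have [t] := unimod Q idQ subPQ Qa Qb.
exact: jacobson_ideal1.
Qed.

End HeitmannStep.

(** * The stable range theorem *)

Theorem mainTheorem4 (A : comPzRingType) (n : nat) (a : A) (b : n.-tuple A) :
  Hdim_lt A n ->
  ideal_gen (a :: b) 1 ->
  exists x : n.-tuple A,
    ideal_gen [tuple tnth b i + a * tnth x i | i < n] 1.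
Proof.
elim: n A a b => [|n IHn] A a b.
  move=> /= A_trivial _; exists [tuple].
  by rewrite A_trivial; exists (fun=> 0); rewrite big1 // => i _; rewrite mul0r.
case/tupleP: b => b0 b Hdim unimod.
pose f := heitmann_proj A b0.
have unimod_f : ideal_gen (f a :: map_tuple f b) 1.
  have [G0 GD GM] := ideal_gen_ideal _ (f a :: map_tuple f b).
  rewrite -(rmorph1 f).
  apply: (ideal_gen_min A _ (fun z => ideal_gen (f a :: map_tuple f b) (f z))
    1 (is_ideal_preimage _ _ f _ (ideal_gen_ideal _ _)) _ unimod).
  move=> y; rewrite !inE => /or3P[/eqP->|/eqP->|b_y].
  - by apply: ideal_gen_mem; rewrite inE eqxx.
  - by rewrite /f heitmann_proj_self.
  - by apply: ideal_gen_mem; rewrite inE map_f ?orbT.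
have [xf gen_f] := IHn _ _ _ (Hdim b0) unimod_f.
pose x := map_tuple (@repr _ _) xf.
pose L := ideal_gen [tuple tnth b i + a * tnth x i | i < n].
have idL : is_ideal A L by apply: ideal_gen_ideal.
have L1 : exists2 z, L z & f z = 1.
  apply: (ideal_gen_min _ _ (fun q => exists2 z, L z & f z = q) 1 _ _ gen_f).
    by apply: is_ideal_image => // q; exists (repr q); apply: heitmann_projK.
  move=> _ /tnthP[i ->]; exists (tnth b i + a * tnth x i).
    by apply/ideal_gen_mem/tnthP; exists i; rewrite tnth_mktuple.
  by rewrite tnth_mktuple !tnth_map rmorphD rmorphM heitmann_projK.
have [y [u [z [Jy Lz def1]]]] := heitmann_quot_lift A b0 L L1.
exists [tuple of y :: x].
set s := [tuple _ | i < n.+1]; have idS := ideal_gen_ideal A s.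
have S_mem i : ideal_gen s (tnth [tuple of b0 :: b] i
                             + a * tnth [tuple of y :: x] i).
  by apply/ideal_gen_mem/tnthP; exists i; rewrite tnth_mktuple.
apply: (boundary_congruence A (ideal_gen s) a b0 y u z) => //.
- by have := S_mem ord0; rewrite !tnth0.
- apply: (ideal_gen_min A _ _ z idS _ Lz) => _ /tnthP[i ->].
  by have := S_mem (lift ord0 i); rewrite !tnthS tnth_mktuple.
move=> Q idQ subQ Qa Qb0; have [Q0 QD QM] := idQ.
apply: (ideal_gen_min A _ Q 1 idQ _ unimod) => c.
rewrite !inE => /or3P[/eqP->|/eqP->|/tnthP[i ->]] //.
(* Modulo [Q] the entry [b_i] is the generator [b_i + a x_i] minus [x_i a]. *)
have := subQ _ (S_mem (lift ord0 i)); rewrite !tnthS => Qi.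
have -> : tnth b i = tnth b i + a * tnth x i + (- tnth x i) * a by ring.
by apply: QD => //; apply: QM.
Qed.
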